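(* Let $X$ and $Y$ be Banach spaces, let $N$ be an absolute normalized norm on $\mathbb R^2$, and let $\gamma>0$ be such that $N(\cdot)\geq\gamma\|\cdot\|_1$. Then (a) $\mathcal T^s(X\oplus_N Y)\geq2\gamma\big(\min\{\mathcal T^s(X),\mathcal T^s(Y)\}-1\big)$; (b) $\mathcal T(X\oplus_N Y)\geq2\gamma\big(\min\{\mathcal T(X),\mathcal T(Y)\}-1\big)$; (c) $\mathcal T^{cc}(X\oplus_N Y)\geq2\gamma\big(\min\{\mathcal T^{cc}(X),\mathcal T^{cc}(Y)\}-1\big)$. In particular, $\mathcal T(X\oplus_p Y)\geq2^{1/p}\big(\min\{\mathcal T(X),\mathcal T(Y)\}-1\big)$ whenever $1<p<\infty$.
   Context: All Banach spaces are nontrivial and real. $B_X$ and $S_X$ denote the closed unit ball and the unit sphere of $X$, $X^*$ is the dual, and $B(x,r)$ is the ball with center $x$ and radius $r$. A norm $N$ on $\mathbb R^2$ is absolute if $N(a,b)=N(|a|,|b|)$ for all $(a,b)\in\mathbb R^2$, and normalized if $N(1,0)=N(0,1)=1$. $X\oplus_N Y$ is $X\times Y$ with the norm $\|(x,y)\|_N=N(\|x\|,\|y\|)$; it is written $X\oplus_pY$ when $N$ is the $\ell_p$-norm $\|\cdot\|_p$. A slice of $B_X$ is a set $S(B_X,x^*,\alpha)=\{x\in B_X: x^*(x)>1-\alpha\}$ with $x^*\in S_{X^*}$ and $\alpha>0$. A convex combination of subsets $W_1,\dots,W_n$ of $B_X$ is a set $\sum_{i=1}^n\lambda_iW_i=\{\sum_i\lambda_iw_i: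 w_i\in W_i\}$ with $n\in\mathbb N$, $\lambda_i\in[0,1]$, $\sum_{i=1}^n\lambda_i=1$. The Daugavet indices of thickness are: - $\mathcal T^s(X)=\inf\{r>0:$ there exist $x\in S_X$ and a slice $S$ of $B_X$ such that $S\subset B(x,r)\}$; - $\mathcal T(X)=\inf\{r>0:$ there exist $x\in S_X$ and a relatively weakly open subset $W$ of $B_X$ such that $\emptyset\ne W\subset B(x,r)\}$; - $\mathcal T^{cc}(X)=\inf\{r>0:$ there exist $x\in S_X$ and a convex combination $C$ of relatively weakly open subsets of $B_X$ such that $\emptyset\ne C\subset B(x,r)\}$. *)

(* Defs.v *)
From HB Require Import structures.
From mathcomp Require Import all_boot all_order all_algebra.
From mathcomp Require Import all_classical all_reals all_analysis.
From mathcomp Require Import ring lra.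

Set Implicit Arguments.
Unset Strict Implicit.
Unset Printing Implicit Defensive.

Import Order.TTheory GRing.Theory Num.Theory.
Import numFieldNormedType.Exports.

Local Open Scope classical_set_scope.
Local Open Scope ring_scope.

Section norms_on_the_plane.
Context {R : realType}.
Implicit Type N : R * R -> R.

Record is_norm N : Prop := IsNorm {
  is_normD : forall a b c d, N (a + c, b + d) <= N (a, b) + N (c, d);
  is_normZ : forall l a b, N (l * a, l * b) = `|l| * N (a, b);
  is_norm_eq0 : forall a b, N (a, b) = 0 -> a = 0 /\ b = 0 }.

Definition is_absolute N : Prop := forall a b, N (a, b) = N (`|a|, `|b|).

Definition is_normalized N : Prop := N (1, 0) = 1 /\ N (0, 1) = 1.

End norms_on_the_plane.

Record absNorm (R : realType) := AbsNorm {
  absNorm_fun :> R * R -> R;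
  absNorm_norm : is_norm absNorm_fun;
  absNorm_absolute : is_absolute absNorm_fun;
  absNorm_normalized : is_normalized absNorm_fun }.

Section absNorm_theory.
Context {R : realType} (N : absNorm R).

Lemma absNormD (a b c d : R) : N (a + c, b + d) <= N (a, b) + N (c, d).
Proof. exact: (is_normD (absNorm_norm N)). Qed.

Lemma absNormZ (l a b : R) : N (l * a, l * b) = `|l| * N (a, b).
Proof. exact: (is_normZ (absNorm_norm N)). Qed.

Lemma absNormE (a b : R) : N (a, b) = N (`|a|, `|b|).
Proof. exact: absNorm_absolute. Qed.

Lemma absNorm_le1 (a a' b : R) : 0 <= a -> a <= a' -> N (a, b) <= N (a', b).
Proof.
move=> a0 aa'; have [a'0|a'0] := eqVneq a' 0.
  by have -> : a = a' by apply/eqP; rewrite eq_le aa' a'0.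
have a'gt0 : 0 < a' by rewrite lt_neqAle eq_sym a'0 (le_trans a0).
set t := (1 + a / a') / 2.
have ra1 : a / a' <= 1 by rewrite ler_pdivrMr// mul1r.
have ra0 : 0 <= a / a' by rewrite divr_ge0// ltW.
have t0 : 0 <= t by rewrite /t; lra.
have t1 : 0 <= 1 - t by rewrite /t; lra.
have -> : (a, b) = (t * a' + (1 - t) * - a', t * b + (1 - t) * b).
  by congr pair; rewrite /t; field.
rewrite (le_trans (absNormD _ _ _ _))// !absNormZ !ger0_norm//.
have -> : N (- a', b) = N (a', b).
  by rewrite [LHS]absNormE normrN -absNormE.
by rewrite -mulrDl subrKC mul1r.
Qed.

Lemma absNorm_le2 (a b b' : R) : 0 <= b -> b <= b' -> N (a, b) <= N (a, b').
Proof.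
move=> b0 bb'; have [b'0|b'0] := eqVneq b' 0.
  by have -> : b = b' by apply/eqP; rewrite eq_le bb' b'0.
have b'gt0 : 0 < b' by rewrite lt_neqAle eq_sym b'0 (le_trans b0).
set t := (1 + b / b') / 2.
have rb1 : b / b' <= 1 by rewrite ler_pdivrMr// mul1r.
have rb0 : 0 <= b / b' by rewrite divr_ge0// ltW.
have t0 : 0 <= t by rewrite /t; lra.
have t1 : 0 <= 1 - t by rewrite /t; lra.
have -> : (a, b) = (t * a + (1 - t) * a, t * b' + (1 - t) * - b').
  by congr pair; rewrite /t; field.
rewrite (le_trans (absNormD _ _ _ _))// !absNormZ !ger0_norm//.
have -> : N (a, - b') = N (a, b').
  by rewrite [LHS]absNormE normrN -absNormE.
by rewrite -mulrDl subrKC mul1r.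
Qed.

Lemma absNorm_le (a a' b b' : R) : 0 <= a -> a <= a' -> 0 <= b -> b <= b' ->
  N (a, b) <= N (a', b').
Proof.
by move=> a0 aa' b0 bb'; exact: le_trans (absNorm_le1 _ _ _) (absNorm_le2 _ _ _).
Qed.

Lemma absNormx0 (a : R) : N (a, 0) = `|a|.
Proof.
have := absNormZ a 1 0; rewrite mulr1 mulr0 => ->.
by rewrite (absNorm_normalized N).1 mulr1.
Qed.

Lemma absNorm0x (b : R) : N (0, b) = `|b|.
Proof.
have := absNormZ b 0 1; rewrite mulr1 mulr0 => ->.
by rewrite (absNorm_normalized N).2 mulr1.
Qed.

Lemma absNorm_ge1 (a b : R) : `|a| <= N (a, b).
Proof. by rewrite absNormE -[leLHS]normr_id -[leLHS]absNormx0 absNorm_le2. Qed.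

Lemma absNorm_ge2 (a b : R) : `|b| <= N (a, b).
Proof. by rewrite absNormE -[leLHS]normr_id -[leLHS]absNorm0x absNorm_le1. Qed.

Lemma absNorm_le_l1 (a b : R) : N (a, b) <= `|a| + `|b|.
Proof.
by have := absNormD a 0 0 b; rewrite addr0 add0r absNormx0 absNorm0x.
Qed.

End absNorm_theory.

(* X (+)_N Y; the alias keeps it apart from the canonical normed module X * Y,
   which carries the maximum norm. *)
Definition dsum (R : realType) (N : absNorm R) (X Y : normedModType R) : Type :=
  (X * Y)%type.

Section dsum_normed.
Context {R : realType} (N : absNorm R) (X Y : normedModType R).

HB.instance Definition _ := GRing.Lmodule.copy (dsum N X Y) (X * Y)%type.

Definition dsum_norm (z : dsum N X Y) : R := N (`|z.1|, `|z.2|).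

Let dsum_normD (z w : dsum N X Y) :
  dsum_norm (z + w) <= dsum_norm z + dsum_norm w.
Proof.
by rewrite (le_trans _ (absNormD _ _ _ _ _))// absNorm_le// ler_normD.
Qed.

Let dsum_normZ (l : R) (z : dsum N X Y) :
  dsum_norm (l *: z) = `|l| * dsum_norm z.
Proof. by rewrite /dsum_norm !normrZ absNormZ normr_id. Qed.

Let dsum_norm_eq0 (z : dsum N X Y) : dsum_norm z = 0 -> z = 0.
Proof.
case: z => x y /(is_norm_eq0 (absNorm_norm N))[/= /normr0_eq0-> /normr0_eq0->].
by [].
Qed.

HB.instance Definition _ := @Lmodule_isNormed.Build R (dsum N X Y) dsum_norm
  dsum_normD dsum_normZ dsum_norm_eq0.

Lemma dsum_normE (z : dsum N X Y) : `|z| = N (`|z.1|, `|z.2|).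
Proof. by []. Qed.

End dsum_normed.

Section dsum_complete.
Context {R : realType} (N : absNorm R) (X Y : completeNormedModType R).

Let dsum_cauchy_cvg (F : set_system (dsum N X Y)) :
  ProperFilter F -> cauchy F -> cvg F.
Proof.
move=> FF /cauchy_ballP F_cauchy.
have c1 : cvg ((fun z : dsum N X Y => z.1) @ F).
  apply: cauchy_cvg; apply/cauchy_ballP => e e0.
  have := F_cauchy e e0; rewrite !near_simpl -ball_normE => -[] /= [A B] [FA FB] AB.
  exists ((fun z : dsum N X Y => z.1) @` A, (fun z : dsum N X Y => z.1) @` B).
    by split => /=; [apply: filterS FA => z ?; exists z|
                     apply: filterS FB => z ?; exists z].
  case=> /= _ _ [[z Az <-] [w Bw <-]]; rewrite -ball_normE /=.
  apply: le_lt_trans (AB (z, w) (conj Az Bw)).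
  by rewrite dsum_normE (le_trans _ (absNorm_ge1 _ _ _))// normr_id.
have c2 : cvg ((fun z : dsum N X Y => z.2) @ F).
  apply: cauchy_cvg; apply/cauchy_ballP => e e0.
  have := F_cauchy e e0; rewrite !near_simpl -ball_normE => -[] /= [A B] [FA FB] AB.
  exists ((fun z : dsum N X Y => z.2) @` A, (fun z : dsum N X Y => z.2) @` B).
    by split => /=; [apply: filterS FA => z ?; exists z|
                     apply: filterS FB => z ?; exists z].
  case=> /= _ _ [[z Az <-] [w Bw <-]]; rewrite -ball_normE /=.
  apply: le_lt_trans (AB (z, w) (conj Az Bw)).
  by rewrite dsum_normE (le_trans _ (absNorm_ge2 _ _ _))// normr_id.
move/cvg_ex : c1 => [x Fx]; move/cvg_ex : c2 => [y Fy].
apply/cvg_ex; exists ((x, y) : dsum N X Y); apply/cvgrPdist_lt => e e0.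
have e20 : 0 < e / 2 by rewrite divr_gt0.
near=> z; rewrite dsum_normE (le_lt_trans (absNorm_le_l1 _ _ _))// !normr_id.
rewrite (splitr e) ltrD//=; near: z.
- by move/cvgrPdist_lt : Fx => /(_ _ e20).
- by move/cvgrPdist_lt : Fy => /(_ _ e20).
Unshelve. all: by end_near. Qed.

HB.instance Definition _ :=
  Uniform_isComplete.Build (dsum N X Y) dsum_cauchy_cvg.

End dsum_complete.

Section lp_norm.
Context {R : realType} (p : R) (p1 : 1 <= p).

Definition lp_norm (u : R * R) : R := (`|u.1| `^ p + `|u.2| `^ p) `^ p^-1.

Let p0 : 0 < p. Proof. exact: lt_le_trans p1. Qed.
Let pn0 : p != 0. Proof. by rewrite gt_eqF. Qed.

Let S (u : R * R) := `|u.1| `^ p + `|u.2| `^ p.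

Let S_ge0 u : 0 <= S u. Proof. by rewrite addr_ge0 ?powR_ge0. Qed.

Let lp_norm_ge0 u : 0 <= lp_norm u. Proof. exact: powR_ge0. Qed.

Let lp_normK u : lp_norm u `^ p = S u.
Proof. by rewrite /lp_norm -powRrM mulVf// powRr1. Qed.

Let powR_inj0 (x : R) : 0 <= x -> x `^ p = 0 -> x = 0.
Proof. by move=> x0 /eqP; rewrite powR_eq0 pn0 andbT => /eqP. Qed.

Let lp_norm_eq0 (a b : R) : lp_norm (a, b) = 0 -> a = 0 /\ b = 0.
Proof.
move=> N0; have := lp_normK (a, b); rewrite N0 powR0// => /esym/eqP.
rewrite paddr_eq0 ?powR_ge0//= => /andP[/eqP a0 /eqP b0].
by split; apply: normr0_eq0; apply: powR_inj0.
Qed.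

Let lp_normZ (l a b : R) : lp_norm (l * a, l * b) = `|l| * lp_norm (a, b).
Proof.
rewrite /lp_norm /= !normrM !powRM// -mulrDr powRM ?powR_ge0//.
by rewrite -powRrM mulfV// powRr1.
Qed.

Let powR_le_convex (t x y : R) : 0 <= t -> t <= 1 -> 0 <= x -> 0 <= y ->
  (t * x + (1 - t) * y) `^ p <= t * x `^ p + (1 - t) * y `^ p.
Proof.
move=> t0 t1 x0 y0.
have := @convex_powR R p p1 (Itv01 t0 t1) x y.
rewrite !inE/= !in_itv/= !andbT => /(_ x0 y0).
by rewrite !convRE.
Qed.

Let lp_normD (a b c d : R) :
  lp_norm (a + c, b + d) <= lp_norm (a, b) + lp_norm (c, d).
Proof.
have := lp_normK (a, b); have := lp_norm_ge0 (a, b).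
have := @lp_norm_eq0 a b; have := lp_normK (c, d).
have := lp_norm_ge0 (c, d); have := @lp_norm_eq0 c d.
case: (eqVneq (lp_norm (a, b)) 0) => [A0 _ _ _ /(_ A0)[a0 b0] _ _|].
  by rewrite A0 a0 b0 !add0r.
case: (eqVneq (lp_norm (c, d)) 0) => [B0 _ /(_ B0)[c0 d0] _ _ _ _ _|].
  by rewrite B0 c0 d0 !addr0.
move: (lp_norm (a, b)) (lp_norm (c, d)) => A B B0 A0 _ Bge0 KB _ Age0 KA.
have Agt0 : 0 < A by rewrite lt_neqAle eq_sym A0.
have Bgt0 : 0 < B by rewrite lt_neqAle eq_sym B0.
have ABgt0 : 0 < A + B by rewrite addr_gt0.
pose t := A / (A + B).
have t0 : 0 <= t by rewrite divr_ge0// ltW.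
have t1 : t <= 1 by rewrite ler_pdivrMr// mul1r lerDl ltW.
have tC : 1 - t = B / (A + B) by rewrite /t; field; rewrite gt_eqF.
have powRV z : 0 <= z -> z^-1 `^ p = (z `^ p)^-1.
  by move=> z0; rewrite -[in LHS]powR_inv1// -powRrM mulN1r powRN.
have key (x y : R) : `|x + y| `^ p <=
    (A + B) `^ p * (t * (`|x| `^ p / A `^ p) + (1 - t) * (`|y| `^ p / B `^ p)).
  have xyE : `|x| + `|y| = (A + B) * (t * (`|x| / A) + (1 - t) * (`|y| / B)).
    by rewrite tC /t; field; rewrite A0 B0 gt_eqF.
  apply: (@le_trans _ _ ((`|x| + `|y|) `^ p)).
    by apply: ge0_ler_powR; rewrite ?nnegrE ?addr_ge0 ?ler_normD ?(ltW p0).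
  have q0 : 0 <= `|x| / A by rewrite divr_ge0// ltW.
  have q1 : 0 <= `|y| / B by rewrite divr_ge0// ltW.
  rewrite xyE powRM ?(ltW ABgt0)//; last first.
    by rewrite addr_ge0// mulr_ge0// subr_ge0.
  rewrite ler_wpM2l ?powR_ge0// (le_trans (powR_le_convex t0 t1 q0 q1))//.
  rewrite !powRM ?invr_ge0 ?(ltW Agt0) ?(ltW Bgt0)//.
  by rewrite !powRV ?(ltW Agt0) ?(ltW Bgt0).
have le1 : S (a + c, b + d) <= (A + B) `^ p.
  rewrite (le_trans (lerD (key a c) (key b d)))// -mulrDr.
  rewrite -[leRHS]mulr1 ler_wpM2l ?powR_ge0// KA KB.
  have SA : S (a, b) != 0 by rewrite -KA powR_eq0 negb_and A0.
  have SB : S (c, d) != 0 by rewrite -KB powR_eq0 negb_and B0.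
  rewrite addrACA -!mulrDr -!mulrDl -[_ + `|b| `^ p]/(S (a, b)).
  by rewrite -[_ + `|d| `^ p]/(S (c, d)) !mulfV// !mulr1 subrKC.
have -> : A + B = ((A + B) `^ p) `^ p^-1.
  by rewrite -powRrM mulfV// powRr1// ltW.
by apply: ge0_ler_powR; rewrite ?nnegrE ?powR_ge0 ?invr_ge0 ?(ltW p0) ?S_ge0.
Qed.

Lemma lp_norm_is_norm : is_norm lp_norm.
Proof. by split; [exact: lp_normD|exact: lp_normZ|exact: lp_norm_eq0]. Qed.

Lemma lp_norm_is_absolute : is_absolute lp_norm.
Proof. by move=> a b; rewrite /lp_norm /= !normr_id. Qed.

Lemma lp_norm_is_normalized : is_normalized lp_norm.
Proof.
by split; rewrite /lp_norm/= normr1 normr0 powR1 powR0// ?addr0 ?add0r powR1.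
Qed.

Definition lp_absNorm : absNorm R :=
  AbsNorm lp_norm_is_norm lp_norm_is_absolute lp_norm_is_normalized.

End lp_norm.

Section thickness.
Context {R : realType} (X : normedModType R).

Definition unit_ball : set X := closed_ball 0 1.

Definition unit_sphere : set X := [set x | `|x| = 1].

Definition dual : Type := {f : {linear X -> R^o} | continuous f}.

Definition dual_fun (f : dual) : X -> R := sval f.

Coercion dual_fun : dual >-> Funclass.

Definition dual_norm (f : dual) : R := sup [set `|f x| | x in unit_ball].

Definition slice (f : dual) (alpha : R) : set X :=
  [set x | unit_ball x /\ f x > 1 - alpha].

Definition is_slice (S : set X) : Prop :=
  exists (f : dual) (alpha : R),
    [/\ dual_norm f = 1, 0 < alpha & S = slice f alpha].

(* The weak topology: the coarsest one making all elements of the dual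
   continuous. *)
Definition weak : topologicalType :=
  sup_topology (fun f : dual => Topological.on (initial_topology f)).

Definition rel_weakly_open (W : set X) : Prop :=
  exists2 U : set X, @open weak U & W = U `&` unit_ball.

Definition convex_comb (n : nat) (lambda : 'I_n -> R) (W : 'I_n -> set X) :
    set X :=
  [set x | exists2 w : 'I_n -> X,
     (forall i, W i (w i)) & x = \sum_(i < n) lambda i *: w i].

Definition is_rwo_convex_comb (C : set X) : Prop :=
  exists (n : nat) (lambda : 'I_n -> R) (W : 'I_n -> set X),
    [/\ forall i, 0 <= lambda i <= 1, \sum_(i < n) lambda i = 1,
        forall i, rel_weakly_open (W i) & C = convex_comb lambda W].

(* B(x, r) is the closed ball below; open balls give the same infima. *)
Definition thickness_s : R := inf [set r | 0 < r /\
  exists (x : X) (S : set X),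
    [/\ unit_sphere x, is_slice S & S `<=` closed_ball x r]].

Definition thickness : R := inf [set r | 0 < r /\
  exists (x : X) (W : set X),
    [/\ unit_sphere x, rel_weakly_open W, W !=set0 & W `<=` closed_ball x r]].

Definition thickness_cc : R := inf [set r | 0 < r /\
  exists (x : X) (C : set X),
    [/\ unit_sphere x, is_rwo_convex_comb C, C !=set0
      & C `<=` closed_ball x r]].

End thickness.

(* Main.v *)
(* Every slice (resp. relatively weakly open set, convex combination of those)
   C of the ball of X (+)_N Y contains a set {(a x, b y) : x in U, y in V}, with
   U and V of the same kind in B_X and B_Y and with a + b as close to 1 as
   desired.  Pick x in U and y in V almost as far as possible from the
   directions u, v of the center (c u, d v), |u| = |v| = 1.  Then |u - x| > t
   gives |c u - a x| >= (a + c)(t - 1), and likewise in Y, so the distance from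
   (a x, b y) to the center is at least gamma (a + b + c + d)(t - 1), where
   c + d >= N(c, d) = 1.
   For weakly open sets, a + b >= 1 requires points of norm one, which exist
   because positive thickness of X makes every weak neighbourhood of 0 in X
   unbounded. *)
From HB Require Import structures.
Require Import Defs.
From mathcomp Require Import all_boot all_order all_algebra.
From mathcomp Require Import all_classical all_reals all_analysis.
From mathcomp Require Import lra.

Import Order.TTheory GRing.Theory Num.Theory.
Import numFieldNormedType.Exports.

Set Implicit Arguments.
Unset Strict Implicit.
Unset Printing Implicit Defensive.

Local Open Scope classical_set_scope.
Local Open Scope ring_scope.

Lemma unit_ballE {R : realType} {X : normedModType R} (x : X) :
  unit_ball x = (`|x| <= 1) :> Prop.
Proof. by rewrite /unit_ball closed_ballE// /closed_ball_/= add0r normrN. Qed.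

(** * Basic neighbourhoods of the weak topology *)

Section weak_topology.
Context {R : realType} {X : normedModType R}.

Definition weak_near (fs : seq (dual X)) (e : R) (x y : X) : bool :=
  all (fun f : dual X => `|f (y - x)| < e) fs.

Lemma dualB (f : dual X) (x y : X) : f (x - y) = f x - f y.
Proof. by case: f => f cf; rewrite /dual_fun/= raddfB. Qed.

Lemma dualD (f : dual X) (x y : X) : f (x + y) = f x + f y.
Proof. by case: f => f cf; rewrite /dual_fun/= raddfD. Qed.

Lemma dualZ (f : dual X) (a : R) (x : X) : f (a *: x) = a * f x.
Proof. by case: f => f cf; rewrite /dual_fun/= linearZ. Qed.

Lemma weak_near_filter (x : X) :
  Filter [set A : set X | exists2 fse : seq (dual X) * R, 0 < fse.2 &
    [set y | weak_near fse.1 fse.2 x y] `<=` A].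
Proof.
split=> [|A B [[fs e] /= e0 fsA] [[gs d] /= d0 gsB]|A B AB [fse e0 fsA]].
- by exists ([::], 1).
- exists (fs ++ gs, Num.min e d); rewrite /= ?lt_min ?e0// => y.
  rewrite /weak_near /= all_cat => /andP[yfs ygs]; split.
    by apply: fsA; apply: sub_all yfs => f /=; rewrite lt_min => /andP[].
  by apply: gsB; apply: sub_all ygs => f /=; rewrite lt_min => /andP[].
- by exists fse => //; exact: subset_trans AB.
Qed.

(** The filter generated by the sets [weak_near fs e x] converges to [x] in the initial topology of
    each single functional, hence in their supremum, which is the weak topology. *)
Lemma weak_open_near (U : set X) (x : X) : @open (weak X) U -> U x ->
  exists2 fse : seq (dual X) * R, 0 < fse.2 &
    forall y, weak_near fse.1 fse.2 x y -> U y.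
Proof.
move=> oU Ux; pose F := [set A : set X | exists2 fse : seq (dual X) * R,
  0 < fse.2 & [set y | weak_near fse.1 fse.2 x y] `<=` A].
suff : cvg_to F (@nbhs (weak X) (weak X) x).
  by move=> /(_ U); apply; exact: open_nbhs_nbhs.
have FF : Filter F by exact: weak_near_filter.
apply/cvg_sup => f A [_ [[B oB <-] /= Bfx BA]].
have /nbhs_ballP[e /= e0 eB] : nbhs (f x : R^o) B by exact: open_nbhs_nbhs.
exists ([:: f], e) => //= y; rewrite /weak_near/= andbT => fxy.
by apply: BA; apply: eB; rewrite -ball_normE /= distrC -dualB.
Qed.

Lemma weak_open_preimage (f : dual X) (B : set R^o) : open B ->
  @open (weak X) [set y | B (f y)].
Proof.
move=> oB; rewrite openE => y /= Bfy.
have /cvg_sup/(_ f) : @nbhs (weak X) (weak X) y --> (y : weak X) by exact: cvg_id.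
apply; exists [set y | B (f y)]; split => //.
by exists B.
Qed.

Lemma weak_open_weak_near (fs : seq (dual X)) (e : R) (x : X) :
  @open (weak X) [set y | weak_near fs e x y].
Proof.
elim: fs => [|f fs IH].
  rewrite (_ : [set _ | _] = setT); first exact: openT.
  by apply/seteqP; split.
rewrite (_ : [set _ | _] = [set y | ball (f x : R^o) e (f y)] `&`
   [set y | weak_near fs e x y]).
  by apply: openI => //; apply: weak_open_preimage; exact: ball_open.
apply/seteqP; split => y; rewrite /= /weak_near/= -ball_normE/= distrC.
  by rewrite -dualB => /andP[].
by rewrite -dualB => -[-> ->].
Qed.

End weak_topology.

(** * The indices as infima of radii, and unbounded weak neighbourhoods *)

Section thickness_radii.
Context {R : realType} {X : normedModType R}.

(** Treats the three indices uniformly: [thickness] and [thickness_cc] are [inf (radii F)] by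
    definition, and [thickness_s] is so once slices are known to be nonempty. *)
Definition radii (F : set (set X)) : set R := [set r | 0 < r /\
  exists (x : X) (W : set X),
    [/\ unit_sphere x, F W, W !=set0 & W `<=` closed_ball x r]].

Lemma radii_lbound (F : set (set X)) : has_lbound (radii F).
Proof. by exists 0 => r [/ltW]. Qed.

Lemma inf_radii_ge0 (F : set (set X)) : 0 <= inf (radii F).
Proof.
have [->|/set0P ne] := eqVneq (radii F) set0; first by rewrite inf0.
by apply: lb_le_inf => // r [/ltW].
Qed.

(** The infimum of the empty set is 0 by convention. A positive index therefore provides a unit
    vector and a member of the family. *)
Lemma inf_gt0_nonempty (E : set R) : 0 < inf E -> E !=set0.
Proof.
by move=> E0; apply/set0P; apply: contraTN E0 => /eqP ->; rewrite inf0 ltxx.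
Qed.

(** This is how a lower bound on an index is used: if no such point existed, [W] would lie in the
    closed ball of radius [r] around [u], and [r] would be an admissible radius below the
    infimum. *)
Lemma lt_inf_radii (F : set (set X)) (r : R) (u : X) (W : set X) :
  0 < r -> r < inf (radii F) -> `|u| = 1 -> F W -> W !=set0 ->
  exists2 x, W x & r < `|u - x|.
Proof.
move=> r0 rF u1 FW W0; apply: contrapT => far.
have : radii F r.
  split=> //; exists u, W; split=> // x Wx; rewrite closed_ballE//=.
  by rewrite /closed_ball_ /= leNgt; apply/negP => rux; apply: far; exists x.
by move/(ge_inf (radii_lbound F)); rewrite leNgt rF.
Qed.

Lemma radii2 (F : set (set X)) (u : X) (W : set X) : W `<=` @unit_ball R X ->
  `|u| = 1 -> F W -> W !=set0 -> radii F 2.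
Proof.
move=> WB u1 FW W0; split=> //; exists u, W; split=> // x /WB.
rewrite unit_ballE closed_ballE// /closed_ball_/= => x1.
by rewrite (le_trans (ler_normB _ _))// u1 -[leRHS]/(1 + 1 : R) lerD2l.
Qed.

Lemma normr_normalize (x : X) : x != 0 -> `| `|x|^-1 *: x| = 1.
Proof.
by move=> x0; rewrite normrZ normfV normr_id mulVf// normr_eq0.
Qed.

Lemma normrK_normalize (x : X) : `|x| *: (`|x|^-1 *: x) = x.
Proof.
have [->|x0] := eqVneq x 0; first by rewrite !scaler0.
by rewrite scalerA mulfV ?scale1r// normr_eq0.
Qed.

Lemma rel_weakly_open_unit_ball : rel_weakly_open (@unit_ball R X).
Proof. by exists setT; [exact: openT|rewrite setTI]. Qed.

Lemma unit_ball0 : @unit_ball R X 0.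
Proof. by rewrite unit_ballE normr0. Qed.

Lemma rel_weakly_open_sub (W : set X) : rel_weakly_open W -> W `<=` @unit_ball R X.
Proof. by case=> U _ -> x []. Qed.

Lemma weak_near_refl (fs : seq (dual X)) (e : R) (x : X) : 0 < e ->
  weak_near fs e x x.
Proof.
move=> e0; elim: fs => //= f fs IH.
by rewrite /weak_near /= [X in _ && X]IH dualB subrr normr0 e0.
Qed.

Lemma weak_nearZ (fs : seq (dual X)) (e k : R) (x y : X) : 0 < k ->
  weak_near fs (e / k) x y -> weak_near fs e 0 (k *: (y - x)).
Proof.
move=> k0; apply: sub_all => f /=.
by rewrite subr0 dualZ normrM gtr0_norm// ltr_pdivlMr// mulrC.
Qed.

(* A bounded weak neighbourhood of 0 can be shrunk by homotheties, so that the
   weak topology is the norm topology and some relatively weakly open sets lie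
   in arbitrarily small balls centered on the sphere. *)
Lemma weak_near_unbounded (fs : seq (dual X)) (e M : R) :
  0 < thickness X -> 0 < e -> exists2 q, weak_near fs e 0 q & M < `|q|.
Proof.
move=> T0 e0; apply: contrapT => bnd.
have {}bnd q : weak_near fs e 0 q -> `|q| <= Num.max M 1.
  move=> qe; rewrite leNgt; apply/negP => Mq; apply: bnd; exists q => //.
  by apply: le_lt_trans Mq; rewrite le_max lexx.
have [_ [_ [u [_ [u1 _ _ _]]]]] := inf_gt0_nonempty T0.
have M0 : 0 < Num.max M 1 by rewrite lt_max ltr01 orbT.
move: (Num.max M 1) M0 bnd => K K0 bnd.
have t0 : 0 < thickness X / 2 by rewrite divr_gt0.
pose k := K / (thickness X / 2).
have k0 : 0 < k by rewrite divr_gt0.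
pose W := [set y | weak_near fs (e / k) u y] `&` @unit_ball R X.
have WX : rel_weakly_open W by exists [set y | weak_near fs (e / k) u y] => //; exact: weak_open_weak_near.
have Wu : W u.
  split; last by rewrite unit_ballE u1.
  by apply: weak_near_refl; rewrite divr_gt0.
have tT : thickness X / 2 < inf (radii (@rel_weakly_open R X)).
  by rewrite -[ltRHS]/(thickness X) ltr_pdivrMr// ltr_pMr// ltr1n.
have [|x [xu _]] := lt_inf_radii t0 tT u1 WX; first by exists u.
move/(weak_nearZ k0)/bnd : xu; rewrite normrZ gtr0_norm// distrC => le ltr.
have : k * (thickness X / 2) < k * `|u - x| by rewrite ltr_pM2l.
by rewrite {1}/k divfK ?gt_eqF// ltNge le.
Qed.

End thickness_radii.

(** * Functionals, their norms, and slices *)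

Section dual_operations.
Context {R : realType}.

Lemma nonexpansive_linear_continuous (V W : normedModType R)
  (f : {linear V -> W}) : (forall x, `|f x| <= `|x|) -> continuous f.
Proof.
move=> f1 x; apply/(@cvgrPdist_lt _ _ _ (nbhs x)) => e e0; near=> z.
rewrite -linearB; apply: le_lt_trans (f1 _) _.
near: z; exact: cvgr_dist_lt.
Unshelve. all: by end_near. Qed.

Definition dual_comp (V W : normedModType R) (g : {linear V -> W})
  (g1 : forall x, `|g x| <= `|x|) (f : dual W) : dual V :=
  exist (fun f : {linear V -> R^o} => continuous f) (sval f \o g)
    (fun x => continuous_comp (nonexpansive_linear_continuous g1 (x := x))
                              (svalP f (g x))).

Lemma dual_compE (V W : normedModType R) (g : {linear V -> W})
  (g1 : forall x, `|g x| <= `|x|) (f : dual W) x :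
  dual_comp g1 f x = f (g x).
Proof. by []. Qed.

Lemma dual_scale_continuous (V : normedModType R) (a : R) (f : dual V) :
  continuous (a \*: sval f : V -> R^o).
Proof. by move=> x; apply: continuousZl_tmp; exact: svalP f x. Qed.

Definition dual_scale (V : normedModType R) (a : R) (f : dual V) : dual V :=
  exist (fun f : {linear V -> R^o} => continuous f) (a \*: sval f)
    (@dual_scale_continuous V a f).

Lemma dual_scaleE (V : normedModType R) (a : R) (f : dual V) x :
  dual_scale a f x = a * f x.
Proof. by []. Qed.

Lemma le_dual_norm (V : normedModType R) (f : dual V) (M : R) (x : V) :
  (forall x, `|x| <= 1 -> `|f x| <= M) -> `|x| <= 1 -> `|f x| <= dual_norm f.
Proof.
move=> fM x1; apply: ub_le_sup; last by exists x; rewrite ?unit_ballE.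
by exists M => _ [y + <-]; rewrite unit_ballE => /fM.
Qed.

Lemma dual_norm_le (V : normedModType R) (f : dual V) (M : R) :
  (forall x, `|x| <= 1 -> `|f x| <= M) -> dual_norm f <= M.
Proof.
move=> fM; apply: ge_sup.
  by exists `|f 0|; exists 0 => //; rewrite unit_ballE normr0.
by move=> _ [y + <-]; rewrite unit_ballE => /fM.
Qed.

(** [sup] takes the default value 0 on a set without supremum, and the value 1 excludes this. *)
Lemma dual_norm1_has_sup (V : normedModType R) (f : dual V) :
  dual_norm f = 1 -> has_sup [set `|f x| | x in @unit_ball R V].
Proof.
move=> f1; apply: contrapT => /sup_out.
by rewrite -[LHS]/(dual_norm f) f1 => /eqP; rewrite oner_eq0.
Qed.

Lemma dual_norm1_le (V : normedModType R) (f : dual V) (x : V) :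
  dual_norm f = 1 -> `|x| <= 1 -> `|f x| <= 1.
Proof.
move=> f1 x1; have [_ fub] := dual_norm1_has_sup f1.
by rewrite -f1 ub_le_sup//; exists x; rewrite ?unit_ballE.
Qed.

(** A point of the ball where the absolute value of the functional is close to its supremum 1 lies
    in the slice, possibly after a change of sign. *)
Lemma slice_nonempty (V : normedModType R) (S : set V) :
  is_slice S -> S !=set0.
Proof.
move=> [f [a [f1 a0 ->]]].
have [_ [x Bx <-]] := sup_adherent a0 (dual_norm1_has_sup f1).
rewrite -[sup _]/(dual_norm f) f1 => ax.
have [fx|fx] := leP 0 (f x); first by exists x; split; rewrite // -(ger0_norm fx).
exists (- x); split; last by rewrite -[- x]scaleN1r dualZ mulN1r -(ltr0_norm fx).
by rewrite unit_ballE normrN -unit_ballE.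
Qed.

Lemma slice_sub (V : normedModType R) (S : set V) :
  is_slice S -> S `<=` @unit_ball R V.
Proof. by move=> [f [a [_ _ ->]]] x []. Qed.

(** Meant for the restriction of a norm-one functional of the sum to one summand, whose norm [p]
    need not be 1. If [p] is positive, the slice of width [d / p] of the normalized functional
    works; if [p = 0], any slice does, whence the assumption that one exists. *)
Lemma almost_norming_slice (V : normedModType R) (f : dual V) (M d : R) :
  (forall x, `|x| <= 1 -> `|f x| <= M) -> (exists S : set V, is_slice S) ->
  0 < d -> exists2 S : set V, is_slice S &
    forall x y, S x -> `|y| <= 1 -> f y - d <= f x.
Proof.
move=> fM [S0 sS0] d0; have fp x := le_dual_norm (x := x) fM.
have p0 : 0 <= dual_norm f.
  by apply: le_trans (fp 0 _); rewrite ?normr0.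
have [pz|pn] := eqVneq (dual_norm f) 0.
  exists S0 => // x y /(slice_sub sS0); rewrite unit_ballE => /fp + /fp.
  rewrite pz !normr_le0 => /eqP -> /eqP ->.
  by rewrite sub0r oppr_le0 ltW.
have pgt0 : 0 < dual_norm f by rewrite lt_neqAle eq_sym pn.
set p := dual_norm f in fp p0 pn pgt0.
pose g := dual_scale p^-1 f.
have g1 x : `|x| <= 1 -> `|g x| <= 1.
  move=> x1; rewrite dual_scaleE normrM gtr0_norm ?invr_gt0//.
  by rewrite mulrC ler_pdivrMr// mul1r fp.
exists (slice g (d / p)).
  exists g, (d / p); split=> //; last by rewrite divr_gt0.
  apply/eqP; rewrite eq_le dual_norm_le//= -(ler_pM2l pgt0) mulr1.
  (* What remains is that the norm of [g] is at least 1; multiplied by [p], this is a bound on the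
     norm of [f]. *)
  apply: dual_norm_le => x x1; apply: le_trans (_ : p * `|g x| <= _).
    by rewrite dual_scaleE normrM gtr0_norm ?invr_gt0// mulrA mulfV// mul1r.
  by rewrite ler_pM2l// (le_dual_norm g1).
move=> x y [_]; rewrite dual_scaleE => gx /fp fy.
have : p * (1 - d / p) < p * (p^-1 * f x) by rewrite ltr_pM2l.
rewrite mulrA mulfV// mul1r mulrBr mulr1 mulrCA mulfV// mulr1.
move: (ler_norm (f y)) fy; lra.
Qed.

End dual_operations.

(** * Embeddings and projections of the sum, and its weakly open sets *)

Section direct_sum.
Context {R : realType} (N : absNorm R) (X Y : normedModType R).
Local Notation Z := (dsum N X Y).

(** The four maps are named constants so that linear structures into or out of the space normed by
    [N] can be attached to them, as [dual_comp] requires. *)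
Definition dsum_inl (x : X) : Z := (x, 0).
Definition dsum_inr (y : Y) : Z := (0, y).
Definition dsum_fst (z : Z) : X := z.1.
Definition dsum_snd (z : Z) : Y := z.2.

Let dsum_inl_linear : linear dsum_inl.
Proof. by move=> a x x'; congr pair; rewrite /= scaler0 addr0. Qed.
HB.instance Definition _ :=
  GRing.isLinear.Build R X Z _ dsum_inl dsum_inl_linear.

Let dsum_inr_linear : linear dsum_inr.
Proof. by move=> a x x'; congr pair; rewrite /= scaler0 addr0. Qed.
HB.instance Definition _ :=
  GRing.isLinear.Build R Y Z _ dsum_inr dsum_inr_linear.

Let dsum_fst_linear : linear dsum_fst. Proof. by []. Qed.
HB.instance Definition _ :=
  GRing.isLinear.Build R Z X _ dsum_fst dsum_fst_linear.

Let dsum_snd_linear : linear dsum_snd. Proof. by []. Qed.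
HB.instance Definition _ :=
  GRing.isLinear.Build R Z Y _ dsum_snd dsum_snd_linear.

Lemma norm_dsum_inl (x : X) : `|dsum_inl x| = `|x|.
Proof. by rewrite dsum_normE normr0 absNormx0 normr_id. Qed.

Lemma norm_dsum_inr (y : Y) : `|dsum_inr y| = `|y|.
Proof. by rewrite dsum_normE normr0 absNorm0x normr_id. Qed.

Lemma norm_dsum_fst (z : Z) : `|dsum_fst z| <= `|z|.
Proof. by rewrite dsum_normE -[leLHS]normr_id absNorm_ge1. Qed.

Lemma norm_dsum_snd (z : Z) : `|dsum_snd z| <= `|z|.
Proof. by rewrite dsum_normE -[leLHS]normr_id absNorm_ge2. Qed.

Lemma dsum_eta (z : Z) : z = dsum_inl z.1 + dsum_inr z.2.
Proof. by case: z => x y; congr pair; rewrite /= ?addr0 ?add0r. Qed.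

Let norm_dsum_inl_le x : `|dsum_inl x| <= `|x|.
Proof. by rewrite norm_dsum_inl. Qed.

Let norm_dsum_inr_le y : `|dsum_inr y| <= `|y|.
Proof. by rewrite norm_dsum_inr. Qed.

Definition dual_inl (f : dual Z) : dual X := dual_comp norm_dsum_inl_le f.
Definition dual_inr (f : dual Z) : dual Y := dual_comp norm_dsum_inr_le f.

Lemma dual_dsumE (f : dual Z) (x : X) (y : Y) :
  f ((x, y) : Z) = dual_inl f x + dual_inr f y.
Proof. by rewrite [X in f X]dsum_eta dualD. Qed.

Lemma weak_near_inl (fs : seq (dual Z)) (e : R) (z : Z) (q : X) :
  weak_near (map dual_inl fs) e 0 q -> weak_near fs e z (z + dsum_inl q).
Proof.
rewrite /weak_near all_map; apply: sub_all => f /=.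
by rewrite subr0 addrC addKr.
Qed.

(** Starting at a point of [W], follow a long vector of the summand X that is small for the finitely
    many functionals defining a neighbourhood. The segment stays in that neighbourhood, and by the
    intermediate value theorem it meets the unit sphere. *)
Lemma rel_weakly_open_sphere (W : set Z) : 0 < thickness X ->
  rel_weakly_open W -> W !=set0 -> exists2 z, W z & `|z| = 1.
Proof.
move=> TX [U oU ->] [z [Uz]]; rewrite unit_ballE => z1.
have [[fs e] /= e0 fsU] := weak_open_near oU Uz.
(* As [z] has norm at most 1, a [q] of norm above 2 brings the end of the segment out to norm at
   least 1. *)
have [q qe q3] := weak_near_unbounded (map dual_inl fs) 2 TX e0.
pose g (t : R) := `|z + t *: dsum_inl q|.
have gc : continuous g.
  move=> t; apply: cvg_norm; apply: cvgD; first exact: cvg_cst.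
  exact: scalel_continuous.
have g0 : g 0 = `|z| by rewrite /g scale0r addr0.
have g1 : 1 <= g 1.
  rewrite /g scale1r addrC; have := lerB_normD (dsum_inl q) z.
  rewrite norm_dsum_inl; lra.
have /(IVT ler01 (continuous_subspaceT gc))[t] :
    Num.min (g 0) (g 1) <= 1 <= Num.max (g 0) (g 1).
  by rewrite ge_min le_max g0 z1 g1 orbT.
rewrite in_itv/= => /andP[t0 t1] gt1; exists (z + t *: dsum_inl q) => //.
split; last by rewrite unit_ballE -[leLHS]/(g t) gt1.
rewrite -linearZ; apply: fsU; apply: weak_near_inl.
apply: sub_all qe => f /=; rewrite !subr0 dualZ normrM ger0_norm//.
by apply: le_lt_trans; rewrite ler_piMl.
Qed.

Lemma weak_near_split (fs : seq (dual Z)) (e a b : R) (x x' : X) (y y' : Y) :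
  0 <= a <= 1 -> 0 <= b <= 1 ->
  weak_near (map dual_inl fs) (e / 2) x x' ->
  weak_near (map dual_inr fs) (e / 2) y y' ->
  weak_near fs e ((a *: x, b *: y) : Z) ((a *: x', b *: y') : Z).
Proof.
move=> /andP[a0 a1] /andP[b0 b1]; rewrite /weak_near; elim: fs => //= f fs IH.
move=> /andP[fx /IH {}IH] /andP[fy /IH ->]; rewrite andbT.
rewrite -[_ - _]/((a *: x' - a *: x, b *: y' - b *: y) : Z) -!scalerBr.
rewrite dual_dsumE !dualZ (le_lt_trans (ler_normD _ _))//.
rewrite !normrM (ger0_norm a0) (ger0_norm b0) (splitr e) ltrD//.
- by apply: le_lt_trans fx; rewrite ler_piMl.
- by apply: le_lt_trans fy; rewrite ler_piMl.
Qed.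

Lemma norm_inv_scale_le1 (V : normedModType R) (x : V) : `| `|x|^-1 *: x| <= 1.
Proof.
have [->|x0] := eqVneq x 0; first by rewrite scaler0 normr0.
by rewrite normr_normalize.
Qed.

Lemma norm_dsum_scale (a b : R) (x : X) (y : Y) : 0 <= a -> 0 <= b ->
  `|x| <= 1 -> `|y| <= 1 -> `|(a *: x, b *: y) : Z| <= N (a, b).
Proof.
move=> a0 b0 x1 y1; rewrite dsum_normE !normrZ !ger0_norm//.
by rewrite absNorm_le ?mulr_ge0// ler_piMr.
Qed.

(** Take weak neighbourhoods of the normalized components of [z]. Scaling by the norms of the
    components, which are at most 1, shrinks the errors, and the scaled pairs have norm at most that
    of [z]. *)
Lemma rel_weakly_open_split (W : set Z) (z : Z) : rel_weakly_open W -> W z ->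
  exists (U : set X) (V : set Y),
    [/\ rel_weakly_open U, U !=set0, rel_weakly_open V, V !=set0 &
      forall x y, U x -> V y -> W ((`|z.1| *: x, `|z.2| *: y) : Z)].
Proof.
move=> [G oG ->] [Gz]; rewrite unit_ballE => z1.
have [[fs e] /= e0 fsG] := weak_open_near oG Gz.
have e20 : 0 < e / 2 by rewrite divr_gt0.
(* A vanishing component is normalized to 0, which is still in the ball and still gives back the
   component after scaling. *)
pose x := `|z.1|^-1 *: z.1; pose y := `|z.2|^-1 *: z.2.
exists ([set x' | weak_near (map dual_inl fs) (e / 2) x x'] `&` @unit_ball R X),
  ([set y' | weak_near (map dual_inr fs) (e / 2) y y'] `&` @unit_ball R Y).
split.
- by exists [set x' | weak_near (map dual_inl fs) (e / 2) x x'];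
    first exact: weak_open_weak_near.
- exists x; split; last by rewrite unit_ballE norm_inv_scale_le1.
  exact: weak_near_refl.
- by exists [set y' | weak_near (map dual_inr fs) (e / 2) y y'];
    first exact: weak_open_weak_near.
- exists y; split; last by rewrite unit_ballE norm_inv_scale_le1.
  exact: weak_near_refl.
move=> x' y' [xx' +] [yy' +]; rewrite !unit_ballE => x'1 y'1; split.
  apply: fsG; rewrite {1}(_ : z = ((`|z.1| *: x, `|z.2| *: y) : Z)).
    by apply: weak_near_split => //; rewrite normr_ge0 /=
      ?(le_trans (norm_dsum_fst z)) ?(le_trans (norm_dsum_snd z)).
  by rewrite !normrK_normalize -surjective_pairing.
by apply: le_trans (norm_dsum_scale _ _ x'1 y'1) _.
Qed.

End direct_sum.

(** * Lower bounds in the sum: the common estimate, slices, weakly open sets *)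

Section thickness_direct_sum.
Context {R : realType}.

(** Up to a vector of norm at most [|a - c|], the difference is [max a c] times [u - x]. Hence its
    norm is at least [max a c * (t - 1) + min a c], and [t <= 2] gives
    [min a c >= min a c * (t - 1)]. *)
Lemma norm_shift_ge (V : normedModType R) (a c t : R) (u x : V) :
  0 <= a -> 0 <= c -> t <= 2 -> `|u| = 1 -> `|x| <= 1 -> t <= `|u - x| ->
  (a + c) * (t - 1) <= `|c *: u - a *: x|.
Proof.
move=> a0 c0 t2 u1 x1 tux; have [ca|ac] := leP c a.
  have -> : c *: u - a *: x = a *: (u - x) - (a - c) *: u.
    by rewrite scalerBr scalerBl opprB [RHS]addrC addrA subrK.
  apply: le_trans (lerB_dist _ _); rewrite !normrZ u1 !ger0_norm ?subr_ge0//.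
  have := ler_wpM2l a0 tux; nra.
have -> : c *: u - a *: x = c *: (u - x) - (a - c) *: x.
  by rewrite scalerBr scalerBl opprB addrA subrK.
have ca0 : a - c <= 0 by rewrite subr_le0 ltW.
apply: le_trans (lerB_dist _ _); rewrite !normrZ (ger0_norm c0) (ler0_norm ca0).
have := ler_wpM2l c0 tux; have : - (a - c) * `|x| <= - (a - c).
  by rewrite ler_piMr// oppr_ge0.
nra.
Qed.

Lemma sphere_direction (V : normedModType R) (v x : V) : `|v| = 1 ->
  exists2 u : V, `|u| = 1 & x = `|x| *: u.
Proof.
move=> v1; have [->|x0] := eqVneq x 0; first by exists v; rewrite ?normr0 ?scale0r.
exists (`|x|^-1 *: x); first exact: normr_normalize.
by rewrite normrK_normalize.
Qed.

(** The common core of the three inequalities. The last two hypotheses are conditioned on [1 < m]: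
    otherwise the left-hand side is nonpositive, while [1 < m] makes both indices positive, which
    the constructions in the sum rely on. *)
Lemma inf_radii_dsum (N : absNorm R) (X Y : normedModType R)
  (FX : set (set X)) (FY : set (set Y)) (FZ : set (set (dsum N X Y)))
  (gamma : R) (m := Num.min (inf (radii FX)) (inf (radii FY))) :
  0 < gamma -> (forall a b : R, gamma * (`|a| + `|b|) <= N (a, b)) ->
  (forall U, FX U -> U `<=` @unit_ball R X) ->
  (forall V, FY V -> V `<=` @unit_ball R Y) ->
  (1 < m -> exists W, [/\ FZ W, W !=set0 & W `<=` @unit_ball R (dsum N X Y)]) ->
  (1 < m -> forall C e, FZ C -> C !=set0 -> 0 < e ->
    exists (a b : R) (U : set X) (V : set Y),
      [/\ [/\ 0 <= a, 0 <= b & 1 - e <= a + b], FX U /\ U !=set0,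
          FY V /\ V !=set0 &
          forall x y, U x -> V y -> C ((a *: x, b *: y) : dsum N X Y)]) ->
  2 * gamma * (m - 1) <= inf (radii FZ).
Proof.
move=> g0 gN FX1 FY1 + + ; have [m1 _ _|m1 /(_ isT)[W [FW W0 W1]] /(_ isT) split] := leP m 1.
  apply: le_trans (inf_radii_ge0 _); apply: mulr_ge0_le0; last by rewrite subr_le0.
  by rewrite mulr_ge0// ltW.
have /andP[mX mY] : (m <= inf (radii FX)) && (m <= inf (radii FY)).
  by rewrite -le_min.
have [|rX [_ [u [U [u1 FU U0 _]]]]] := @inf_gt0_nonempty _ (radii FX).
  by apply: lt_le_trans mX; apply: lt_trans m1.
have [|rY [_ [v [V [v1 FV V0 _]]]]] := @inf_gt0_nonempty _ (radii FY).
  by apply: lt_le_trans mY; apply: lt_trans m1.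
have m2 : m <= 2.
  by apply: le_trans mX (ge_inf (radii_lbound _) (radii2 (FX1 _ FU) u1 FU U0)).
apply: lb_le_inf.
  by exists 2; apply: (radii2 W1 _ FW W0 (u := dsum_inl N Y u)); rewrite norm_dsum_inl.
move=> r [r0 [z [C [z1 FC C0 Cr]]]]; apply/ler_addgt0Pr => e e0.
(* The first bound keeps the total loss below [e], the second keeps [m - d] above 1. *)
pose d := Num.min (e / (3 * gamma)) ((m - 1) / 2).
have d0 : 0 < d by rewrite lt_min !divr_gt0 ?mulr_gt0 ?subr_gt0.
have de : 3 * gamma * d <= e.
  by rewrite mulrC -ler_pdivlMr ?mulr_gt0// ge_min lexx.
have dm : d <= (m - 1) / 2 by rewrite ge_min lexx orbT.
have [a [b [U' [V' [[a0 b0 ab] [FU' U'0] [FV' V'0] UVC]]]]] := split C d FC C0 d0.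
have [u' u'1 zu] := sphere_direction z.1 u1.
have [v' v'1 zv] := sphere_direction z.2 v1.
have t0 : 0 < m - d by lra.
have tX : m - d < inf (radii FX) by apply: lt_le_trans mX; lra.
have tY : m - d < inf (radii FY) by apply: lt_le_trans mY; lra.
have [x Ux ux] := lt_inf_radii t0 tX u'1 FU' U'0.
have [y Vy vy] := lt_inf_radii t0 tY v'1 FV' V'0.
have /Cr := UVC x y Ux Vy; rewrite closed_ballE// /closed_ball_/= => zr.
have {}zr : gamma * (`|z.1 - a *: x| + `|z.2 - b *: y|) <= r.
  by apply: le_trans zr; rewrite dsum_normE -[X in X + _]normr_id -[X in _ + X]normr_id.
have x1 : `|x| <= 1 by rewrite -unit_ballE; exact: FX1 Ux.
have y1 : `|y| <= 1 by rewrite -unit_ballE; exact: FY1 Vy.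
have td : m - d <= 2 by lra.
have := norm_shift_ge a0 (normr_ge0 z.1) td u'1 x1 (ltW ux); rewrite -zu => lex.
have := norm_shift_ge b0 (normr_ge0 z.2) td v'1 y1 (ltW vy); rewrite -zv => ley.
have zz : 1 <= `|z.1| + `|z.2|.
  have := absNorm_le_l1 N (`|z.1|) (`|z.2|).
  by rewrite !normr_id -dsum_normE z1.
(* The factor [2 - d] collects [a + b >= 1 - d] and the bound [zz] on the center. *)
have le1 : gamma * ((2 - d) * (m - d - 1)) <= r.
  apply: le_trans zr; rewrite ler_pM2l//; apply: le_trans (lerD lex ley).
  rewrite -mulrDl ler_wpM2r//; lra.
(* Expanding, [(2 - d) * (m - 1 - d)] is [2 * (m - 1) - d * (2 + (m - 1)) + d * d], and [m <= 2]
   bounds the loss by [3 * d]. *)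
have : d * (2 + (m - 1)) <= d * 3 by rewrite ler_pM2l//; lra.
move=> /(ler_wpM2l (ltW g0)); move: (mulr_ge0 (ltW g0) (mulr_ge0 (ltW d0) (ltW d0))).
move: le1 de; clear; nra.
Qed.

Lemma thickness_s_dsum (N : absNorm R) (X Y : normedModType R) (gamma : R) :
  0 < gamma -> (forall a b : R, gamma * (`|a| + `|b|) <= N (a, b)) ->
  2 * gamma * (Num.min (thickness_s X) (thickness_s Y) - 1)
    <= thickness_s (dsum N X Y).
Proof.
have radiiE (V : normedModType R) : [set r | 0 < r /\ exists (x : V) (S : set V),
    [/\ unit_sphere x, is_slice S & S `<=` closed_ball x r]] = radii (@is_slice R V).
  apply/seteqP; split=> r [r0 [x [S]]] => [[x1 sS Sr]|[x1 sS _ Sr]];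
    by split=> //; exists x, S; split=> //; exact: slice_nonempty.
move=> g0 gN; rewrite /thickness_s !radiiE; apply: inf_radii_dsum => //.
- by move=> U; exact: slice_sub.
- by move=> U; exact: slice_sub.
- rewrite lt_min => /andP[/(lt_trans ltr01)/inf_gt0_nonempty + _].
  move=> [_ [_ [_ [_ [_ [f [a [f1 a0 _]]] _ _]]]]].
  (* The ball of the sum has a slice: a norm-one functional of X composed with the projection keeps
     norm one. *)
  pose g : dual (dsum N X Y) := dual_comp (@norm_dsum_fst R N X Y) f.
  have sg : is_slice (slice g a).
    exists g, a; split=> //; rewrite -f1; congr sup; apply/seteqP; split.
      move=> _ [z + <-]; rewrite unit_ballE => z1; exists (dsum_fst z) => //.
      by rewrite unit_ballE (le_trans (norm_dsum_fst z)).
    move=> _ [x + <-]; rewrite unit_ballE => x1; exists (dsum_inl N Y x) => //.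
    by rewrite unit_ballE norm_dsum_inl.
  by exists (slice g a); split=> //; [exact: slice_nonempty|exact: slice_sub].
- rewrite lt_min => /andP[/(lt_trans ltr01)/inf_gt0_nonempty exX].
  move=> /(lt_trans ltr01)/inf_gt0_nonempty exY _ e [f [al [f1 al0 ->]]] _ e0.
  have {}exX : exists S : set X, is_slice S.
    by move: exX => [_ [_ [_ [S [_ sS _ _]]]]]; exists S.
  have {}exY : exists S : set Y, is_slice S.
    by move: exY => [_ [_ [_ [S [_ sS _ _]]]]]; exists S.
  (* Width [al] puts [z] in the given slice; width [e] gives [1 - e < f z], and [f z] is at most the
     norm of [z], hence at most the sum of the norms of its components. *)
  have sf : is_slice (slice f (Num.min al e)) by exists f, (Num.min al e); rewrite lt_min al0.
  have [z [+ fz]] := slice_nonempty sf; rewrite unit_ballE => z1.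
  have fX x : `|x| <= 1 -> `|dual_inl f x| <= 1.
    by move=> x1; rewrite dual_compE dual_norm1_le ?norm_dsum_inl.
  have fY y : `|y| <= 1 -> `|dual_inr f y| <= 1.
    by move=> y1; rewrite dual_compE dual_norm1_le ?norm_dsum_inr.
  have [fza fze] : 1 - al < f z /\ 1 - e < f z.
    by split; apply: le_lt_trans fz; rewrite lerD2l lerN2 ge_min lexx ?orbT.
  (* Replacing each normalized component of [z] costs at most [d], so a third of the margin is left
     and the inequality stays strict. *)
  pose d := (f z - (1 - al)) / 3.
  have d0 : 0 < d by rewrite divr_gt0// subr_gt0.
  have [U sU Ud] := almost_norming_slice fX exX d0.
  have [V sV Vd] := almost_norming_slice fY exY d0.
  have z11 : `|z.1| <= 1 := le_trans (norm_dsum_fst z) z1.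
  have z21 : `|z.2| <= 1 := le_trans (norm_dsum_snd z) z1.
  exists `|z.1|, `|z.2|, U, V; split.
  + split=> //; have := absNorm_le_l1 N (`|z.1|) (`|z.2|).
    rewrite !normr_id -dsum_normE; apply: le_trans; apply: ltW.
    apply: (lt_le_trans fze).
    have [->|zn] := eqVneq z 0.
      by rewrite -(scale0r (0 : dsum N X Y)) dualZ mul0r.
    rewrite -[X in f X]normrK_normalize dualZ ler_piMr//.
    apply: le_trans (ler_norm _) _; apply: dual_norm1_le => //.
    exact: norm_inv_scale_le1.
  + by split=> //; exact: slice_nonempty.
  + by split=> //; exact: slice_nonempty.
  move=> x y Ux Vy; split.
    rewrite unit_ballE; apply: le_trans z1; apply: norm_dsum_scale => //.
      by rewrite -unit_ballE; exact: slice_sub Ux.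
    by rewrite -unit_ballE; exact: slice_sub Vy.
  have fzE : f z = `|z.1| * dual_inl f (`|z.1|^-1 *: z.1)
                 + `|z.2| * dual_inr f (`|z.2|^-1 *: z.2).
    by rewrite -!dualZ -dual_dsumE !normrK_normalize -surjective_pairing.
  have := ler_wpM2l (normr_ge0 z.1) (Ud x _ Ux (norm_inv_scale_le1 z.1)).
  have := ler_wpM2l (normr_ge0 z.2) (Vd y _ Vy (norm_inv_scale_le1 z.2)).
  rewrite dual_dsumE (dualZ _ _ x) (dualZ _ _ y) !mulrBr.
  have : `|z.1| * d <= d by rewrite ler_piMl// ltW.
  have : `|z.2| * d <= d by rewrite ler_piMl// ltW.
  have : 3 * d = f z - (1 - al) by rewrite /d mulrC divfK.
  move: d0; rewrite fzE; clear; lra.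
Qed.

Lemma thickness_dsum (N : absNorm R) (X Y : normedModType R) (gamma : R) :
  0 < gamma -> (forall a b : R, gamma * (`|a| + `|b|) <= N (a, b)) ->
  2 * gamma * (Num.min (thickness X) (thickness Y) - 1)
    <= thickness (dsum N X Y).
Proof.
move=> g0 gN; apply: inf_radii_dsum => //.
- exact: rel_weakly_open_sub.
- exact: rel_weakly_open_sub.
- move=> _; exists (@unit_ball R (dsum N X Y)); split=> //.
    exact: rel_weakly_open_unit_ball.
  by exists 0; exact: unit_ball0.
rewrite lt_min => /andP[/(lt_trans ltr01) TX _] W e WW W0 e0.
have [z Wz z1] := rel_weakly_open_sphere TX WW W0.
have [U [V [oU U0 oV V0 UVW]]] := rel_weakly_open_split WW Wz.
exists `|z.1|, `|z.2|, U, V; split=> //; split=> //.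
have := absNorm_le_l1 N (`|z.1|) (`|z.2|).
by rewrite !normr_id -dsum_normE z1; apply: le_trans; rewrite gerBl ltW.
Qed.

(** * Convex combinations of relatively weakly open sets *)

Lemma rwo_convex_comb_sub (V : normedModType R) (C : set V) :
  is_rwo_convex_comb C -> C `<=` @unit_ball R V.
Proof.
move=> [n [l [W [l01 l1 oW ->]]]] _ [w Ww ->]; rewrite unit_ballE.
apply: le_trans (ler_norm_sum _ _ _) _; rewrite -l1; apply: ler_sum => i _.
have /andP[li0 _] := l01 i; rewrite normrZ ger0_norm// ler_piMr// -unit_ballE.
exact: rel_weakly_open_sub (oW i) _ (Ww i).
Qed.

Lemma rel_weakly_open_convex_comb (V : normedModType R) (W : set V) :
  rel_weakly_open W -> is_rwo_convex_comb W.
Proof.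
move=> oW; exists 1, (fun=> 1), (fun=> W); split=> // [i||].
- by rewrite ler01 lexx.
- by rewrite big_ord1.
apply/seteqP; split=> x.
  by move=> Wx; exists (fun=> x) => //; rewrite big_ord1 scale1r.
by move=> [w Ww ->]; rewrite big_ord1 scale1r.
Qed.

(** One-term combinations show that the infimum defining [thickness_cc] ranges over more radii.
    Positivity provides a unit vector, so that the radii for weakly open sets do not form the empty
    set, whose infimum would be 0. *)
Lemma thickness_cc_le (V : normedModType R) :
  0 < thickness_cc V -> thickness_cc V <= thickness V.
Proof.
move=> T0; have [_ [_ [x [_ [x1 _ _ _]]]]] := inf_gt0_nonempty T0.
apply: lb_le_inf.
  exists 2; apply: (radii2 (W := @unit_ball R V) _ x1) => //.
    exact: rel_weakly_open_unit_ball.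
  by exists 0; exact: unit_ball0.
move=> r [r0 [y [W [y1 oW W0 Wr]]]]; apply: ge_inf; first exact: radii_lbound.
by split=> //; exists y, W; split=> //; exact: rel_weakly_open_convex_comb.
Qed.

(* The mu i are the weights l i * c i divided by their sum, or the l i
   themselves if that sum vanishes. *)
Lemma renormalized_weights (n : nat) (l c : 'I_n -> R) :
  (forall i, 0 <= l i <= 1) -> \sum_(i < n) l i = 1 -> (forall i, 0 <= c i) ->
  exists mu : 'I_n -> R, [/\ forall i, 0 <= mu i <= 1, \sum_(i < n) mu i = 1
    & forall i, (\sum_(j < n) l j * c j) * mu i = l i * c i].
Proof.
move=> l01 l1 c0; set s := \sum_(j < n) _.
have lc0 i : 0 <= l i * c i by rewrite mulr_ge0//; have /andP[] := l01 i.
have [s0|sn] := eqVneq s 0.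
  exists l; split=> // i; rewrite s0 mul0r; apply/esym/eqP.
  have /eqP := s0; rewrite psumr_eq0// => /allP/(_ i).
  by rewrite mem_index_enum => /(_ isT).
have s0 : 0 < s by rewrite lt_neqAle eq_sym sn sumr_ge0.
exists (fun i => l i * c i / s); split=> [i||i].
- rewrite divr_ge0 ?(ltW s0)//= ler_pdivrMr// mul1r /s (bigD1 i)//=.
  by rewrite lerDl sumr_ge0.
- by rewrite -mulr_suml mulfV.
- by rewrite mulrC divfK.
Qed.

(** Each [W i] contains a point [w i] of norm one and is split at it. Absorbing the norms of the
    components into the weights gives, in each coordinate, a multiple of a convex combination. The
    two multiples add up to at least 1, because the component norms of each [w i] do. *)
Lemma thickness_cc_dsum (N : absNorm R) (X Y : normedModType R) (gamma : R) :
  0 < gamma -> (forall a b : R, gamma * (`|a| + `|b|) <= N (a, b)) ->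
  2 * gamma * (Num.min (thickness_cc X) (thickness_cc Y) - 1)
    <= thickness_cc (dsum N X Y).
Proof.
move=> g0 gN; apply: inf_radii_dsum => //.
- exact: rwo_convex_comb_sub.
- exact: rwo_convex_comb_sub.
- move=> _; exists (@unit_ball R (dsum N X Y)); split=> //.
    by apply: rel_weakly_open_convex_comb; exact: rel_weakly_open_unit_ball.
  by exists 0; exact: unit_ball0.
rewrite lt_min => /andP[/(lt_trans ltr01) Tcc _].
have TX : 0 < thickness X := lt_le_trans Tcc (thickness_cc_le Tcc).
move=> _ e [n [l [W [l01 l1 oW ->]]]] [_ [w0 Ww0 _]] e0.
have /choice[w Ww] i : exists w, W i w /\ `|w| = 1.
  have [|w] := rel_weakly_open_sphere TX (oW i); first by exists (w0 i).
  by exists w.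
have /choice[U] i := rel_weakly_open_split (oW i) (Ww i).1.
move=> /choice[V UV].
have [mu [mu01 mu1 muE]] := renormalized_weights l01 l1 (fun i => normr_ge0 (w i).1).
have [nu [nu01 nu1 nuE]] := renormalized_weights l01 l1 (fun i => normr_ge0 (w i).2).
have l0 i : 0 <= l i by have /andP[] := l01 i.
exists (\sum_(i < n) l i * `|(w i).1|), (\sum_(i < n) l i * `|(w i).2|),
  (convex_comb mu U), (convex_comb nu V); split.
- split; [by rewrite sumr_ge0// => i _; rewrite mulr_ge0..|].
  apply: (@le_trans _ _ 1); first by rewrite gerBl ltW.
  rewrite -big_split/= -l1; apply: ler_sum => i _; rewrite -mulrDr ler_peMr//.
  have := absNorm_le_l1 N (`|(w i).1|) (`|(w i).2|).
  by rewrite !normr_id -dsum_normE (Ww i).2.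
- split; first by exists n, mu, U; split=> // i; have [] := UV i.
  have /choice[x Ux] i : exists x, U i x by have [] := UV i.
  by exists (\sum_(i < n) mu i *: x i), x.
- split; first by exists n, nu, V; split=> // i; have [] := UV i.
  have /choice[y Vy] i : exists y, V i y by have [] := UV i.
  by exists (\sum_(i < n) nu i *: y i), y.
move=> _ _ [x Ux ->] [y Vy ->].
exists (fun i => (`|(w i).1| *: x i, `|(w i).2| *: y i) : dsum N X Y).
  by move=> i; have [_ _ _ _] := UV i; exact.
rewrite [RHS]dsum_eta; rewrite [LHS]dsum_eta; congr (dsum_inl _ _ _ + dsum_inr _ _ _).
- rewrite -[RHS]/(dsum_fst _) [RHS]linear_sum /= scaler_sumr; apply: eq_bigr => i _.
  by rewrite scalerA muE -scalerA.
- rewrite -[RHS]/(dsum_snd _) [RHS]linear_sum /= scaler_sumr; apply: eq_bigr => i _.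
  by rewrite scalerA nuE -scalerA.
Qed.

(** * Comparison of the norms of l_p and l_1 on the plane *)

Lemma lp_norm_ge_l1 (p a b : R) : 1 <= p ->
  2 `^ p^-1 / 2 * (`|a| + `|b|) <= lp_norm p (a, b).
Proof.
move=> p1; have p0 : 0 < p := lt_le_trans ltr01 p1.
have pn0 : p != 0 by rewrite gt_eqF.
have h0 : 0 <= (2^-1 : R) by rewrite invr_ge0.
have h1 : (2^-1 : R) <= 1 by rewrite invf_le1// ler1n.
have h2 : 1 - 2^-1 = 2^-1 :> R by lra.
(* Convexity of the power at the midpoint; the claim follows by taking the root of order [p] and
   multiplying by the factor with exponent [p^-1]. *)
have cvx : (2^-1 * `|a| + (1 - 2^-1) * `|b|) `^ p <=
    2^-1 * `|a| `^ p + (1 - 2^-1) * `|b| `^ p.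
  have := @convex_powR R p p1 (Itv01 h0 h1) `|a| `|b|.
  rewrite !inE/= !in_itv/= !andbT => /(_ (normr_ge0 a) (normr_ge0 b)).
  by rewrite !convRE.
rewrite h2 -!mulrDr in cvx.
have s0 : 0 <= `|a| `^ p + `|b| `^ p by rewrite addr_ge0 ?powR_ge0.
have ab0 : 0 <= 2^-1 * (`|a| + `|b|) by rewrite mulr_ge0// addr_ge0.
have abE : 2^-1 * (`|a| + `|b|) = ((2^-1 * (`|a| + `|b|)) `^ p) `^ p^-1.
  by rewrite -powRrM mulfV// powRr1.
rewrite -mulrA abE.
apply: le_trans (_ : 2 `^ p^-1 * (2^-1 * (`|a| `^ p + `|b| `^ p)) `^ p^-1 <= _).
  rewrite ler_wpM2l ?powR_ge0//; apply: ge0_ler_powR => //.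
  - by rewrite invr_ge0 ltW.
  - by rewrite nnegrE powR_ge0.
  - by rewrite nnegrE mulr_ge0.
by rewrite -powRM ?mulr_ge0// mulrA mulfV// mul1r.
Qed.

End thickness_direct_sum.

Theorem proposition2p2 (R : realType) (X Y : completeNormedModType R)
    (hX : exists x : X, x != 0) (hY : exists y : Y, y != 0) :
  (forall (N : absNorm R) (gamma : R), 0 < gamma ->
    (forall a b : R, gamma * (`|a| + `|b|) <= N (a, b)) ->
    [/\ 2 * gamma * (Num.min (thickness_s X) (thickness_s Y) - 1)
          <= thickness_s (dsum N X Y),
        2 * gamma * (Num.min (thickness X) (thickness Y) - 1)
          <= thickness (dsum N X Y)
      & 2 * gamma * (Num.min (thickness_cc X) (thickness_cc Y) - 1)
          <= thickness_cc (dsum N X Y)]) /\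
  (forall (p : R) (hp : 1 < p),
    2 `^ (p^-1) * (Num.min (thickness X) (thickness Y) - 1)
      <= thickness (dsum (lp_absNorm (ltW hp)) X Y)).
Proof.
split=> [N gamma g0 gN|p hp].
  split; [exact: thickness_s_dsum|exact: thickness_dsum|exact: thickness_cc_dsum].
(* The constant [gamma] for the l_p norm is half of the target constant. *)
have -> : 2 `^ p^-1 = 2 * (2 `^ p^-1 / 2) :> R by rewrite mulrC divfK.
apply: thickness_dsum => [|a b]; first by rewrite divr_gt0// powR_gt0.
exact: lp_norm_ge_l1 (ltW hp).
Qed.
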